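(* Let $M^{2n}$, $n\geq 3$, be a Kaehler manifold of real dimension $2n$. If $M^{2n}$ has positive holomorphic sectional curvature at some point, then there is no isometric immersion of $M^{2n}$ into $\mathbb{H}^{2n+p}$ for $p\leq n-2$.
   Context: $\mathbb{H}^{N}$ denotes the $N$-dimensional hyperbolic space of constant sectional curvature $-1$. Let $J$ be the complex structure of $M^{2n}$. The holomorphic sectional curvatures at $x\in M^{2n}$ are the sectional curvatures $K_P$ of the $J$-invariant planes $P=\mathrm{span}\{Z,JZ\}\subset T_xM$, $0\neq Z\in T_xM$. Having positive holomorphic sectional curvature at $x$ means that $K_P>0$ for every such plane $P\subset T_xM$. Isometric immersions are isometric only for the Riemannian metrics. *)

(* Defs.v *)
From HB Require Import structures.
From mathcomp Require Import all_boot all_order all_algebra.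
From mathcomp Require Import all_classical all_reals all_analysis.

Set Implicit Arguments.
Unset Strict Implicit.
Unset Printing Implicit Defensive.

Import Order.TTheory GRing.Theory Num.Theory.
Import numFieldNormedType.Exports.

Local Open Scope classical_set_scope.
Local Open Scope ring_scope.

(* Tangent vectors are represented by the row vector of their components in a
   chart, and endomorphisms by matrices acting on the right of row vectors. *)

Section Calculus.
Context {R : realType}.

Definition partial m (V : normedModType R) (k : 'I_m) (f : 'rV[R]_m -> V) :
    'rV[R]_m -> V :=
  fun y => 'D_(delta_mx 0 k : 'rV[R]_m) f y.

(* C^k on U, meant for open U. *)
Fixpoint Ck_on m (V : normedModType R) (k : nat) (U : set 'rV[R]_m)
    (f : 'rV[R]_m -> V) : Prop :=
  if k is k'.+1 then
    forall i : 'I_m,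
      (forall y, U y -> derivable f y (delta_mx 0 i : 'rV[R]_m)) /\
      Ck_on k' U (partial i f)
  else forall y, U y -> {for y, continuous f}.

Definition smooth_on m (V : normedModType R) (U : set 'rV[R]_m)
    (f : 'rV[R]_m -> V) : Prop :=
  forall k, Ck_on k U f.

End Calculus.

Section Manifold.
Context {R : realType}.

(* Only the restrictions of [chart_map] to [chart_dom] and of [chart_inv] to
   [chart_map @` chart_dom] are meaningful. *)
Record chart (T : topologicalType) (m : nat) := Chart {
  chart_dom : set T;
  chart_map : T -> 'rV[R]_m;
  chart_inv : 'rV[R]_m -> T;
  chart_dom_open : open chart_dom;
  chart_im_open : open (chart_map @` chart_dom);
  chart_mapK : forall x, chart_dom x -> chart_inv (chart_map x) = x;
  chart_map_continuous : forall x, chart_dom x -> {for x, continuous chart_map};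
  chart_inv_continuous :
    forall y, (chart_map @` chart_dom) y -> {for y, continuous chart_inv} }.

Definition chart_im T m (c : chart T m) : set 'rV[R]_m := chart_map c @` chart_dom c.

Definition overlap T m (c c' : chart T m) : set 'rV[R]_m :=
  chart_map c @` (chart_dom c `&` chart_dom c').

Definition transition T m (c c' : chart T m) : 'rV[R]_m -> 'rV[R]_m :=
  chart_map c' \o chart_inv c.

Record smooth_manifold (m : nat) := SmoothManifold {
  carrier :> topologicalType;
  carrier_hausdorff : hausdorff_space carrier;
  carrier_second_countable : @second_countable carrier;
  chart_index : Type;
  atlas : chart_index -> chart carrier m;
  atlas_cover : forall x : carrier, exists c, chart_dom (atlas c) x;
  atlas_smooth : forall c c',
    smooth_on (overlap (atlas c) (atlas c')) (transition (atlas c) (atlas c')) }.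

End Manifold.

Arguments chart R T m : clear implicits.
Arguments smooth_manifold R m : clear implicits.

Section LocalRiemannianGeometry.
Context {R : realType} {m : nat}.

Definition bilin (A : 'M[R]_m) (u v : 'rV[R]_m) : R := (u *m A *m v^T) 0 0.

Variable g : 'rV[R]_m -> 'M[R]_m.

(* The Levi-Civita connection: [christoffel k y j l] is the Christoffel symbol
   \Gamma_{kj}^l at y, so that \nabla_{\partial_k} V = \partial_k V + V \Gamma_k. *)
Definition christoffel (k : 'I_m) (y : 'rV[R]_m) : 'M[R]_m :=
  (\matrix_(j, l) (2^-1 * (partial k g y j l + partial j g y k l
                           - partial l g y k j))) *m invmx (g y).

(* V *m [curv_mx i j y] = R(\partial_i, \partial_j) V, with
   R(X, Y) = [\nabla_X, \nabla_Y] - \nabla_[X, Y]. *)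
Definition curv_mx (i j : 'I_m) (y : 'rV[R]_m) : 'M[R]_m :=
  partial i (christoffel j) y - partial j (christoffel i) y
  + christoffel j y *m christoffel i y - christoffel i y *m christoffel j y.

Definition curvature (y X Y Z : 'rV[R]_m) : 'rV[R]_m :=
  \sum_i \sum_j (X 0 i * Y 0 j) *: (Z *m curv_mx i j y).

(* Sectional curvature of span{X, Y}, for linearly independent X, Y. *)
Definition sectional_curvature (y X Y : 'rV[R]_m) : R :=
  bilin (g y) (curvature y X Y Y) X /
  (bilin (g y) X X * bilin (g y) Y Y - bilin (g y) X Y ^+ 2).

End LocalRiemannianGeometry.

Section Kaehler.
Context {R : realType}.

(* The components of the metric in each chart, with their transformation law;
   'D_u of a transition map is its differential applied to u. *)
Record riemannian_metric m (M : smooth_manifold R m) := RiemannianMetric {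
  metric :> chart_index M -> 'rV[R]_m -> 'M[R]_m;
  metric_smooth : forall c, smooth_on (chart_im (atlas c)) (metric c);
  metric_sym : forall c y, chart_im (atlas c) y -> (metric c y)^T = metric c y;
  metric_pos : forall c y (u : 'rV[R]_m), chart_im (atlas c) y -> u != 0 ->
    0 < bilin (metric c y) u u;
  metric_change : forall c c' y (u v : 'rV[R]_m),
    overlap (atlas c) (atlas c') y ->
    let tau := transition (atlas c) (atlas c') in
    bilin (metric c y) u v = bilin (metric c' (tau y)) ('D_u tau y) ('D_v tau y)
}.

Record almost_complex m (M : smooth_manifold R m) := AlmostComplex {
  cplx :> chart_index M -> 'rV[R]_m -> 'M[R]_m;
  cplx_smooth : forall c, smooth_on (chart_im (atlas c)) (cplx c);
  cplx_sqr : forall c y, chart_im (atlas c) y ->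
    cplx c y *m cplx c y = - 1%:M;
  cplx_change : forall c c' y (u : 'rV[R]_m),
    overlap (atlas c) (atlas c') y ->
    let tau := transition (atlas c) (atlas c') in
    'D_(u *m cplx c y) tau y = 'D_u tau y *m cplx c' (tau y) }.

(* J is orthogonal and parallel for the Levi-Civita connection;
   [kaehler_parallel] reads (\nabla_{\partial_k} J) = 0 in components. *)
Record kaehler_manifold (n : nat) := KaehlerManifold {
  kaehler_base :> smooth_manifold R (2 * n);
  kaehler_metric : riemannian_metric kaehler_base;
  kaehler_J : almost_complex kaehler_base;
  kaehler_hermitian : forall c y (u v : 'rV[R]_(2 * n)),
    chart_im (atlas c) y ->
    bilin (kaehler_metric c y) (u *m kaehler_J c y) (v *m kaehler_J c y)
    = bilin (kaehler_metric c y) u v;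
  kaehler_parallel : forall c y (k : 'I_(2 * n)),
    chart_im (atlas c) y ->
    partial k (kaehler_J c) y
    + kaehler_J c y *m christoffel (kaehler_metric c) k y
    - christoffel (kaehler_metric c) k y *m kaehler_J c y = 0 }.

(* Sectional curvature does not depend on the chart, so one chart around x is
   enough. *)
Definition positive_holomorphic_curvature_at n (M : kaehler_manifold n) (x : M) :
    Prop :=
  exists2 c : chart_index M, chart_dom (atlas c) x &
    let y := chart_map (atlas c) x in
    forall Z : 'rV[R]_(2 * n), Z != 0 ->
      0 < sectional_curvature (kaehler_metric M c) y Z (Z *m kaehler_J M c y).

End Kaehler.

Arguments kaehler_manifold R n : clear implicits.

Section Hyperbolic.
Context {R : realType}.

Definition lorentz N (u v : 'rV[R]_N.+1) : R :=
  - (u 0 ord0 * v 0 ord0) + \sum_(i < N) u 0 (lift ord0 i) * v 0 (lift ord0 i).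

(* The hyperboloid model; its Riemannian metric is the restriction of [lorentz]
   to tangent vectors. *)
Definition hyperbolic_space N : set 'rV[R]_N.+1 :=
  [set z | lorentz z z = -1 /\ 0 < z 0 ord0].

Definition isometric_immersion m (M : smooth_manifold R m)
    (g : riemannian_metric M) N (f : M -> 'rV[R]_N.+1) : Prop :=
  (forall x, hyperbolic_space (f x)) /\
  forall c : chart_index M, let F := f \o chart_inv (atlas c) in
    smooth_on (chart_im (atlas c)) F /\
    forall y, chart_im (atlas c) y ->
      (forall u : 'rV[R]_m, 'D_u F y = 0 -> u = 0) /\
      (forall u v : 'rV[R]_m,
         lorentz ('D_u F y) ('D_v F y) = bilin (g c y) u v).

End Hyperbolic.

(* Main.v *)
Require Import Defs.
From mathcomp Require Import all_boot all_order all_algebra.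
From mathcomp Require Import all_classical all_reals all_analysis.
From mathcomp Require Import ring lra zify.

(** Since hyperbolic space sits in Minkowski space as the unit hyperboloid, an
    isometric immersion of M into it is an isometric map F into Minkowski space
    with <F, F> = -1.  Let al be its second fundamental form there; it takes its
    values in the normal space, a Lorentzian space of dimension p + 1 that
    contains the position vector F.

    The Gauss equation writes the curvature as
      <R(X, Y)Z, W> = <al(Y, Z), al(X, W)> - <al(X, Z), al(Y, W)>,
    and J parallel makes R(X, Y) commute with J.  Together these say that the
    Hermitian part h(X, Y) = al(X, Y) + al(JX, JY), seen through the complex
    valued form beta(X, Y) = (h(X, Y), h(X, JY)), is flat for the indefinite
    product <a, c> - <b, d> of (a, b) and (c, d)  ([herm_flat]).

    The form beta(., X) maps a space of dimension 2n to one of dimension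
    2(p + 1) < 2n, so it has a kernel.  Choose X for which its rank is maximal
    and Z != 0 in the kernel.  By a deformation argument of Moore
    ([moore_image]) beta(Z, Z) lies in the image of beta(., X), and by flatness
    it is orthogonal to that image; hence beta(Z, Z) is isotropic
    ([flat_form_isotropic]).  As h(Z, JZ) = 0, this reads <h(Z, Z), h(Z, Z)> = 0,
    where h(Z, Z) = a + b with a = al(Z, Z) and b = al(JZ, JZ).  With
    c = al(Z, JZ), polarization gives
      4 (<a, b> - <c, c>) = - <a - b, a - b> - 4 <c, c>,
    and the left side is a positive multiple of the holomorphic curvature of Z.
    Finally <al(X, Y), F> = - <X, Y>, so a - b and c are orthogonal to the
    timelike vector F and therefore spacelike: the holomorphic curvature of Z
    is nonpositive ([holomorphic_nonpos]).  Such a Z exists at every point, so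
    positivity fails everywhere.

    The remaining work is to derive the Gauss equation and the commutation with
    J from the coordinate definitions; both rest on the symmetry of second
    derivatives ([derive_comm]). *)

Set Implicit Arguments.
Unset Strict Implicit.
Unset Printing Implicit Defensive.

Import Order.TTheory GRing.Theory Num.Theory.
Import numFieldNormedType.Exports.

Local Open Scope classical_set_scope.
Local Open Scope ring_scope.

(** * Flat bilinear forms *)

Section Bilin.
Context {R : realType} {m : nat}.
Implicit Types (L : 'M[R]_m) (u v w : 'rV[R]_m).

Lemma bilinDl L u v w : bilin L (u + v) w = bilin L u w + bilin L v w.
Proof. by rewrite /bilin !mulmxDl mxE. Qed.

Lemma bilinDr L u v w : bilin L w (u + v) = bilin L w u + bilin L w v.
Proof. by rewrite /bilin linearD mulmxDr mxE. Qed.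

Lemma bilinNl L u v : bilin L (- u) v = - bilin L u v.
Proof. by rewrite /bilin !mulNmx mxE. Qed.

Lemma bilinNr L u v : bilin L u (- v) = - bilin L u v.
Proof. by rewrite /bilin linearN mulmxN mxE. Qed.

Lemma bilinC L u v : L^T = L -> bilin L u v = bilin L v u.
Proof.
move=> LT; rewrite /bilin; have -> : v *m L *m u^T = (u *m L *m v^T)^T.
  by rewrite !trmx_mul trmxK LT mulmxA.
by rewrite [RHS]mxE.
Qed.
End Bilin.

Section MooreFlat.

(** Up to the factor det M, the determinant at [t = s^-1] is a power of [t]
    times the characteristic polynomial of [- M^-1 N] at [s], which has finitely
    many roots. *)
Lemma det_affine_neq0 (R : numFieldType) r (M N : 'M[R]_r) :
  \det M != 0 -> exists2 t : R, t != 0 & \det (M + t *: N) != 0.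
Proof.
move=> M0.
have Mu : M \in unitmx by rewrite unitmxE unitfE.
pose K := - (invmx M *m N).
pose q := 'X * char_poly K.
have q0 : q != 0 by rewrite mulf_neq0 ?polyX_eq0// monic_neq0// char_poly_monic.
have [s sq] : exists s, ~~ root q s.
  apply: contrapT => /forallNP noroot.
  pose rs : seq R := [seq i%:R | i <- iota 0 (size q)].
  have rsq : all (root q) rs.
    by apply/allP => x _; apply: contrapT => /negP; exact: noroot.
  have urs : uniq rs.
    rewrite map_inj_uniq ?iota_uniq//.
    by move=> i j /eqP; rewrite eqr_nat => /eqP.
  by have := max_poly_roots q0 rsq urs; rewrite size_map size_iota ltnn.
have [s0 sK] : s != 0 /\ (char_poly K).[s] != 0.
  by move: sq; rewrite /q rootM rootX negb_or => /andP[].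
exists s^-1; first by rewrite invr_eq0.
have -> : M + s^-1 *: N = s^-1 *: (M *m (s%:M - K)).
  rewrite mulmxBr mul_mx_scalar mulmxN mulmxA mulmxV// mul1mx opprK scalerDr.
  by rewrite scalerA mulVf// scale1r.
rewrite detZ det_mulmx mulf_neq0 ?expf_neq0 ?invr_eq0// mulf_neq0//.
suff -> : \det (s%:M - K) = (char_poly K).[s] by [].
rewrite /char_poly -horner_evalE -det_map_mx; congr (\det _).
by apply/matrixP=> i j; rewrite !mxE/= /horner_eval hornerD hornerN hornerMn hornerX hornerC.
Qed.

(** If [z Q] were outside the row space of [P], then [z Q] together with the
    images under [P] of a basis of a complement of the kernel would be
    [\rank P + 1] independent vectors, and would stay so after replacing [P] by [P + t Q] for
    some [t != 0].  But then [z Q = t^-1 z (P + t Q)] is itself in the row space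
    of [P + t Q], whose rank is at most that of [P]. *)
Lemma moore_image (R : numFieldType) a b (P Q : 'M[R]_(a, b)) (z : 'rV[R]_a) :
  (forall t, (\rank (P + t *: Q)%R <= \rank P)%N) ->
  z *m P = 0 -> (z *m Q <= P)%MS.
Proof.
move=> rmax zP; apply: contrapT => /negP zQ.
have [E EP] : exists E, row_base P = E *m P.
  by apply/submxP; rewrite eq_row_base.
(* [C 0] is free; [C t] stays free for some [t != 0], by a nonvanishing minor. *)
pose C t := col_mx (E *m (P + t *: Q)) (z *m Q).
have C0 : row_free (C 0).
  rewrite /C scale0r addr0 -EP /row_free eqn_leq rank_leq_row/= -addsmxE.
  have lt : (row_base P < row_base P + z *m Q)%MS.
    rewrite ltmxE addsmxSl/=; apply: contraNN zQ => le.
    by rewrite -(eq_row_base P); apply: submx_trans le; exact: addsmxSr.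
  by have := rank_ltmx lt; rewrite eq_row_base addn1; apply.
have [S CS] := row_freeP C0.
have [|t t0 dt] := @det_affine_neq0 _ _ (C 0 *m S) (col_mx (E *m Q) 0 *m S).
  by rewrite CS det1 oner_neq0.
have Ct : C t = C 0 + t *: col_mx (E *m Q) 0.
  by rewrite /C scale_col_mx add_col_mx scaler0 addr0 scale0r addr0 mulmxDr scalemxAr.
have : row_free (C t).
  have u : C t *m S \in unitmx.
    by rewrite unitmxE unitfE Ct mulmxDl -scalemxAl.
  by apply/row_freeP; exists (S *m invmx (C t *m S)); rewrite mulmxA mulmxV.
have CP : (C t <= (P + t *: Q)%R)%MS.
  rewrite /C col_mx_sub; apply/andP; split; first exact: submxMl.
  have -> : z *m Q = (t^-1 *: z) *m (P + t *: Q).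
    by rewrite mulmxDr -scalemxAl zP scaler0 add0r -scalemxAr -scalemxAl scalerA mulfV// scale1r.
  exact: submxMl.
rewrite /row_free => /eqP rC; have := mxrankS CP; rewrite rC => h.
by have := leq_trans h (rmax t); rewrite addn1 ltnn.
Qed.

(** With [P x] of maximal rank and [z] in its kernel, [z P z] belongs to the
    image of [P x] by [moore_image] and is orthogonal to it by flatness. *)
Lemma flat_form_isotropic (R : realType) m k (P : 'rV[R]_m -> 'M[R]_(m, k)) (Q : 'M[R]_k) :
  (forall x y t, P (x + t *: y) = P x + t *: P y) ->
  (forall w z x y, bilin Q (w *m P x) (z *m P y) = bilin Q (z *m P x) (w *m P y)) ->
  (forall x, (\rank (P x) < m)%N) ->
  exists2 z : 'rV[R]_m, z != 0 & bilin Q (z *m P z) (z *m P z) = 0.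
Proof.
move=> Plin flat rk.
pose rkP := fun r : nat => `[< exists x, \rank (P x) = r >].
have ex : exists r, rkP r by exists (\rank (P 0)); apply/asboolP; exists 0.
have ub : forall r, rkP r -> (r <= m)%N.
  by move=> r /asboolP[x <-]; exact: ltnW.
have /asboolP[x xr] : rkP (ex_maxn ex ub) by case: ex_maxnP.
have max y : (\rank (P y) <= \rank (P x))%N.
  by rewrite xr; case: ex_maxnP => r _; apply; apply/asboolP; exists y.
have [i ki] : exists i, row i (kermx (P x)) != 0.
  apply/existsP; rewrite -[X in is_true X]negbK negb_exists; apply/negP => /forallP h.
  have k0 : kermx (P x) = 0.
    by apply/row_matrixP => i; rewrite row0; apply/eqP; have := h i; rewrite negbK.
  by have := mxrank_ker (P x); rewrite k0 mxrank0 => /esym/eqP; rewrite subn_eq0 leqNgt rk.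
exists (row i (kermx (P x))) => //; set z := row _ _.
have zP : z *m P x = 0 by apply/sub_kermxP; exact: row_sub.
have /submxP[u uE] : (z *m P z <= P x)%MS.
  by apply: moore_image zP => t; rewrite -Plin.
by rewrite {1}uE flat zP /bilin !mul0mx mxE.
Qed.
End MooreFlat.

Section FlatAlgebra.
Context {R : realType} {m N : nat}.
Variables (L : 'M[R]_N) (J : 'M[R]_m) (al : 'rV[R]_m -> 'rV[R]_m -> 'rV[R]_N).
Local Notation q := (bilin L).
Hypothesis Lsym : L^T = L.
Hypothesis JJ : J *m J = - 1%:M.
Hypothesis alC : forall X Y, al X Y = al Y X.
Hypothesis alN : forall X Y, al (- X) Y = - al X Y.

(** The right-hand side of the Gauss equation. *)
Definition gauss X Y Z W := q (al Y Z) (al X W) - q (al X Z) (al Y W).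
Hypothesis gaussJ : forall X Y Z W, gauss X Y (Z *m J) (W *m J) = gauss X Y Z W.

(** In the complexification, [herm X Y] and [herm X (Y *m J)] are the real and
    imaginary parts of the (1,1) component of [al]. *)
Definition herm X Y := al X Y + al (X *m J) (Y *m J).

Lemma mulJJ (X : 'rV[R]_m) : X *m J *m J = - X.
Proof. by rewrite -mulmxA JJ mulmxN mulmx1. Qed.

Lemma gauss_pair X Y Z W : gauss X Y Z W = gauss Z W X Y.
Proof.
rewrite /gauss (alC Z Y) (alC W X) (alC Z X) (alC W Y).
by rewrite (bilinC (al Y Z))// (bilinC (al X Z)) // (bilinC (al X W)) // [q (al Y Z) _]bilinC.
Qed.

(** Invariance of the Gauss expression under J in either pair of arguments is
    the Kaehler symmetry of the curvature; expanding both sides bilinearly, the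
    difference is a combination of five instances of it. *)
Lemma herm_flat W Z X Y :
  q (herm W X) (herm Z Y) - q (herm W (X *m J)) (herm Z (Y *m J))
  = q (herm Z X) (herm W Y) - q (herm Z (X *m J)) (herm W (Y *m J)).
Proof.
have gaussJl A B C D : gauss (A *m J) (B *m J) C D = gauss A B C D.
  by rewrite gauss_pair gaussJ -gauss_pair.
have e1 := gaussJl W Z Y X.
have e2 := gaussJ W Z Y X.
have e3 := gaussJl W Z (Y *m J) (X *m J).
have e4 := gaussJ (W *m J) Z (Y *m J) X.
have e5 := gaussJ W (Z *m J) (Y *m J) X.
move: e1 e2 e3 e4 e5.
rewrite /gauss /herm !mulJJ !(alN, alC _ (- _)).
rewrite !(bilinDl, bilinDr, bilinNl, bilinNr) !(alC Y) !(alC X).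
have qC A B : q (al A X) B = q B (al A X) by exact: bilinC.
have qCJ A B : q (al A (X *m J)) B = q B (al A (X *m J)) by exact: bilinC.
rewrite !(qC _ (al _ Y)) !(qC _ (al _ (Y *m J))).
rewrite !(qCJ _ (al _ Y)) !(qCJ _ (al _ (Y *m J))).
lra.
Qed.

End FlatAlgebra.

(** * The Gauss equation as matrix algebra *)

Section GramAlgebra.
Context {R : realType} {m N : nat}.
Variables (L : 'M[R]_N) (D : 'M[R]_(m, N)).
Hypothesis Lsym : L^T = L.
Implicit Types (H : 'I_m -> 'M[R]_(m, N)).

(** For [g = D L D^T], with [H k] the derivative of [D] in direction [k], the
    Koszul combination of derivatives of [g] collapses to the tangential part of
    the second derivatives of the map. *)
Lemma koszul_gram H (dg : 'I_m -> 'M[R]_m) k :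
  (forall i k, row i (H k) = row k (H i)) ->
  (forall k, dg k = H k *m L *m D^T + D *m L *m (H k)^T) ->
  \matrix_(j, l) (2^-1 * (dg k j l + dg j k l - dg l k j)) = H k *m L *m D^T.
Proof.
move=> Hsym dgE; pose B i := H i *m L *m D^T.
have dgB i r s : dg i r s = B i r s + B i s r.
  have BT : D *m L *m (H i)^T = (B i)^T by rewrite /B !trmx_mul trmxK Lsym mulmxA.
  by rewrite dgE BT mxE [X in _ + X]mxE.
have Bsym i r s : B i r s = B r i s.
  have BE t u : B t u s = (row u (H t) *m L *m D^T) 0 s.
    by rewrite -!row_mul [RHS]mxE.
  by rewrite (BE i r) (BE r i) Hsym.
apply/matrixP => j l; rewrite mxE !dgB -/(B k).
rewrite (Bsym j k l) (Bsym l k j) (Bsym l j k); lra.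
Qed.

(** [G] and [Gi] stand for the Christoffel matrices in directions [j] and [i],
    [H] and [Hi] for the second derivatives of the map, and [dG] and [K] for the
    derivatives of [G] and [H] in direction [i].  The last hypothesis is the
    derivative of [G g = H L D^T]; in the conclusion the third derivatives are
    isolated, so that they cancel when [i] and [j] are exchanged. *)
Lemma gauss_codazzi_tangent (g dG G Gi : 'M[R]_m) (H Hi K : 'M[R]_(m, N)) :
  Gi *m g = Hi *m L *m D^T ->
  (H - G *m D) *m L *m D^T = 0 ->
  dG *m g + G *m (Hi *m L *m D^T + D *m L *m Hi^T)
    = K *m L *m D^T + H *m L *m Hi^T ->
  (dG + G *m Gi) *m g
    = K *m L *m D^T + (H - G *m D) *m L *m (Hi - Gi *m D)^T.
Proof.
move=> Gig AD E.
have -> : (H - G *m D) *m L *m (Hi - Gi *m D)^T = (H - G *m D) *m L *m Hi^T.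
  by rewrite linearB /= mulmxBr trmx_mul mulmxA AD mul0mx subr0.
rewrite mulmxDl -mulmxA Gig !mulmxBl.
move: E; rewrite mulmxDr !mulmxA => E.
by rewrite addrA -E addrA addrK.
Qed.

Definition along (A : 'I_m -> 'M[R]_(m, N)) (X : 'rV[R]_m) := \sum_k X 0 k *: A k.

Lemma alongD A X Y t : along A (X + t *: Y) = along A X + t *: along A Y.
Proof.
rewrite /along scaler_sumr -big_split; apply: eq_bigr => k _.
by rewrite !mxE scalerDl scalerA.
Qed.

Lemma along_sym A X Y :
  (forall i k, row i (A k) = row k (A i)) -> Y *m along A X = X *m along A Y.
Proof.
move=> Asym.
have E V W : W *m along A V
    = \sum_k \sum_i (V 0 k * W 0 i) *: row i (A k).
  rewrite mulmx_sumr; apply: eq_bigr => k _.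
  rewrite -scalemxAr mulmx_sum_row scaler_sumr.
  by apply: eq_bigr => i _; rewrite scalerA.
rewrite !E exchange_big; apply: eq_bigr => k _; apply: eq_bigr => i _.
by rewrite mulrC Asym.
Qed.

Lemma gauss_along A (C : 'I_m -> 'I_m -> 'M[R]_m) (g : 'M[R]_m) (X Y Z W : 'rV[R]_m) :
  (forall i k, row i (A k) = row k (A i)) ->
  (forall i j, C i j *m g = A j *m L *m (A i)^T - A i *m L *m (A j)^T) ->
  bilin g (\sum_i \sum_j (X 0 i * Y 0 j) *: (Z *m C i j)) W
  = gauss L (fun V V' => V *m along A V') X Y Z W.
Proof.
move=> Asym Cg; rewrite /gauss !(along_sym Z _ Asym) !(along_sym W _ Asym).
have -> : bilin L (Z *m along A Y) (W *m along A X)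
      - bilin L (Z *m along A X) (W *m along A Y)
   = (Z *m (along A Y *m L *m (along A X)^T
            - along A X *m L *m (along A Y)^T) *m W^T) 0 0.
  rewrite mulmxBr mulmxBl [in RHS]mxE [X in _ = _ + X]mxE /bilin.
  by rewrite !trmx_mul !mulmxA.
rewrite /bilin; congr (fun M : 'M[R]_1 => M 0 0); congr (_ *m _).
rewrite mulmx_suml.
have E V V' : along A V *m L *m (along A V')^T
    = \sum_i \sum_j (V' 0 i * V 0 j) *: (A j *m L *m (A i)^T).
  rewrite exchange_big /along !mulmx_suml; apply: eq_bigr => j _.
  rewrite linear_sum mulmx_sumr; apply: eq_bigr => i _.
  by rewrite linearZ /= -scalemxAr -!scalemxAl scalerA.
rewrite !E [X in _ - X]exchange_big -sumrB mulmx_sumr; apply: eq_bigr => i _.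
rewrite -sumrB mulmx_suml mulmx_sumr; apply: eq_bigr => j _.
rewrite [Y 0 j * _]mulrC -scalerBr -Cg -scalemxAl -scalemxAr.
by rewrite mulmxA.
Qed.

End GramAlgebra.

(** * Minkowski space and the pointwise argument *)

Section Minkowski.
Context {R : realType} {N : nat}.

Definition lorentz_mx : 'M[R]_N.+1 :=
  diag_mx (\row_a (if a == ord0 then -1 else 1)).

Lemma tr_lorentz_mx : lorentz_mx^T = lorentz_mx.
Proof. exact: tr_diag_mx. Qed.

Lemma lorentzE (u v : 'rV[R]_N.+1) : lorentz u v = bilin lorentz_mx u v.
Proof.
rewrite /lorentz /bilin mxE big_ord_recl; congr (_ + _).
  by rewrite mul_mx_diag !mxE eqxx mulrN1 mulNr.
by apply: eq_bigr => i _; rewrite mul_mx_diag !mxE /= mulr1.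
Qed.

(** Expanding [0 <= sum_i (x_0 v_i - v_0 x_i)^2] with [<x, x> = -1] and
    [<v, x> = 0] gives [v_0^2 <= x_0^2 <v, v>]. *)
Lemma lorentz_spacelike (x v : 'rV[R]_N.+1) :
  lorentz x x = -1 -> lorentz v x = 0 -> 0 <= lorentz v v.
Proof.
rewrite /lorentz => xx vx.
have : 0 <= \sum_(i < N) (x 0 ord0 * v 0 (lift ord0 i)
                          - v 0 ord0 * x 0 (lift ord0 i)) ^+ 2.
  by apply: sumr_ge0 => i _; exact: sqr_ge0.
set a := x 0 ord0 in xx vx *; set b := v 0 ord0 in vx *.
set S := \sum_(i < N) _ ^+ 2.
have -> : S = a ^+ 2 * (\sum_(i < N) v 0 (lift ord0 i) * v 0 (lift ord0 i))
   - 2 * a * b * (\sum_(i < N) v 0 (lift ord0 i) * x 0 (lift ord0 i))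
   + b ^+ 2 * (\sum_(i < N) x 0 (lift ord0 i) * x 0 (lift ord0 i)).
  rewrite !mulr_sumr -sumrB -big_split /=; apply: eq_bigr => i _; ring.
move: xx vx; set p := \sum_(i < N) x _ _ * _; set r := \sum_(i < N) v _ _ * x _ _.
set s := \sum_(i < N) v _ _ * v _ _ => xx vx.
have -> : p = a ^+ 2 - 1 by lra.
have -> : r = a * b by lra.
have p0 : 0 <= p by apply: sumr_ge0 => i _; rewrite -expr2 sqr_ge0.
have a0 : 0 < a ^+ 2 by lra.
move=> h; rewrite -(pmulr_rge0 _ a0).
have b0 := sqr_ge0 b.
lra.
Qed.

End Minkowski.

Section Pointwise.
Context {R : realType} {m N : nat}.
(* The rows of [D] span the tangent space, [Y *m A X] is the second fundamental
   form and [x] is the position vector. *)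
Variables (D : 'M[R]_(m, N.+1)) (A : 'rV[R]_m -> 'M[R]_(m, N.+1)).
Variables (J : 'M[R]_m) (x : 'rV[R]_N.+1).
Local Notation eta := (@lorentz_mx R N).
Local Notation q := (bilin eta).
Hypothesis codim : (2 * (N.+1 - m) < m)%N.
Hypothesis Dg : D *m eta *m D^T \in unitmx.
Hypothesis Alin : forall X Y t, A (X + t *: Y) = A X + t *: A Y.
Hypothesis Anormal : forall X, A X *m eta *m D^T = 0.
Hypothesis AC : forall X Y, Y *m A X = X *m A Y.
Hypothesis JJ : J *m J = - 1%:M.
Hypothesis AgaussJ : forall X Y Z W : 'rV[R]_m,
  gauss eta (fun U V => U *m A V) X Y (Z *m J) (W *m J)
  = gauss eta (fun U V => U *m A V) X Y Z W.
Hypothesis xx : lorentz x x = -1.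
Hypothesis AxJ : forall X Y : 'rV[R]_m,
  lorentz (X *m J *m A (Y *m J)) x = lorentz (X *m A Y) x.

Let al (U V : 'rV[R]_m) := U *m A V.

(** The rows of [B] are pairs of vectors normal to the rows of [D], and the normal
    space has dimension [N.+1 - m]. *)
Lemma rank_normal k (B : 'M[R]_(k, N.+1 + N.+1)) :
  B *m block_mx (eta *m D^T) 0 0 (eta *m D^T) = 0 ->
  (\rank B <= 2 * (N.+1 - m))%N.
Proof.
move=> /mulmx0_rank_max; rewrite rank_diag_block_mx.
have -> : \rank (eta *m D^T) = m.
  apply/eqP; rewrite eqn_leq rank_leq_col/=.
  by rewrite -[X in (X <= _)%N](mxrank_unit Dg) -mulmxA mxrankM_maxr.
lia.
Qed.

Lemma holomorphic_nonpos : exists2 Z : 'rV[R]_m, Z != 0 &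
  q (al Z Z) (al (Z *m J) (Z *m J)) - q (al Z (Z *m J)) (al Z (Z *m J)) <= 0.
Proof.
(* [U *m P V] is the pair [beta(U, V)]. *)
pose h X := A X + J *m A (X *m J).
pose P X := row_mx (h X) (h (X *m J)).
have hE U V : U *m h V = herm J al U V by rewrite mulmxDr mulmxA.
have hlin X Y t : h (X + t *: Y) = h X + t *: h Y.
  by rewrite /h mulmxDl -scalemxAl !Alin mulmxDr -scalemxAr scalerDr addrACA.
have alC U V : al U V = al V U by exact: AC.
have alN U V : al (- U) V = - al U V by rewrite /al mulNmx.
pose Q := block_mx eta 0 0 (- eta).
have QE (a b c d : 'rV[R]_N.+1) : bilin Q (row_mx a b) (row_mx c d) = q a c - q b d.
  rewrite /bilin tr_row_mx mul_row_block mul_row_col !mulmx0 addr0 add0r.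
  by rewrite mulmxN mulNmx mxE [X in _ + X]mxE.
have [z z0] : exists2 z : 'rV[R]_m, z != 0 & bilin Q (z *m P z) (z *m P z) = 0.
  apply: flat_form_isotropic.
  - move=> X Y t; rewrite /P hlin mulmxDl -scalemxAl hlin.
    by rewrite scale_row_mx add_row_mx.
  - move=> W Z X Y; rewrite !mul_mx_row !QE !hE; apply: herm_flat => //.
    exact: tr_lorentz_mx.
  - move=> X; apply: leq_ltn_trans codim; apply: rank_normal.
    have hn Y : h Y *m (eta *m D^T) = 0.
      by rewrite mulmxA !mulmxDl Anormal add0r -!mulmxA [A _ *m _]mulmxA Anormal mulmx0.
    by rewrite mul_row_block !mulmx0 addr0 add0r !hn row_mx0.
rewrite mul_mx_row QE !hE => iso; exists z => //.
have zJ0 : herm J al z (z *m J) = 0.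
  by rewrite /herm (mulJJ JJ) [al (z *m J) _]alC alN alC subrr.
have q0 : q 0 0 = 0 by rewrite /bilin !mul0mx mxE.
move: iso; rewrite zJ0 q0 subr0.
rewrite /herm; set a := al z z; set b := al (z *m J) (z *m J); set c := al z (z *m J).
have abx : lorentz (a - b) x = 0.
  by rewrite lorentzE bilinDl bilinNl -!lorentzE AxJ subrr.
have cx : lorentz c x = 0.
  have : lorentz c x = - lorentz c x.
    have cJ : al (z *m J) (z *m J *m J) = - c by rewrite mulJJ// alC alN /c.
    have : lorentz (al (z *m J) (z *m J *m J)) x = lorentz c x by exact: AxJ.
    by rewrite cJ !lorentzE bilinNl => ->.
  lra.
have := lorentz_spacelike xx abx; have := lorentz_spacelike xx cx.
rewrite !lorentzE !(bilinDl, bilinDr, bilinNl, bilinNr).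
rewrite (bilinC b a tr_lorentz_mx); lra.
Qed.

End Pointwise.

(** * Mixed partial derivatives *)

Lemma dist_half_trans (R : realFieldType) (e a b c : R) :
  `|a - c| <= e / 2 -> `|b - c| <= e / 2 -> `|a - b| <= e.
Proof.
move=> ac bc; rewrite (splitr e) -(subrKA c) (le_trans (ler_normD _ _))// lerD//.
by rewrite distrC.
Qed.

Section MixedPartials.
Context {R : realType} {V : normedModType R}.
Implicit Types (f : V -> R) (u v x y : V) (U : set V).

Lemma is_derive_line (W : normedModType R) (f : V -> W) x v (t : R) :
  derivable f (t *: v + x) v ->
  is_derive t 1 (fun h : R => f (h *: v + x)) ('D_v f (t *: v + x)).
Proof.
have E : (fun h : R => h^-1 *: (f (h *: v + (t *: v + x)) - f (t *: v + x))) =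
    (fun h : R => h^-1 *: (f ((h *: 1 + t) *: v + x) - f (t *: v + x))).
  apply/funext => h; rewrite addrA scalerDl -[h *: 1]/(h * 1) mulr1 //.
by rewrite /derivable /derive /= E => ?; split.
Qed.

Lemma segment_mvt f x v (d : R) : 0 <= d ->
  (forall t, 0 <= t <= d -> derivable f (t *: v + x) v) ->
  exists2 c, 0 <= c <= d & f (d *: v + x) - f x = d * 'D_v f (c *: v + x).
Proof.
move=> d0 df.
have [||c] := @MVT_segment _ (fun h => f (h *: v + x))
    (fun h => 'D_v f (h *: v + x)) 0 d d0.
- move=> t; rewrite in_itv/= => /andP[t0 td].
  by apply: is_derive_line; apply: df; rewrite !ltW.
- apply: derivable_within_continuous => t; rewrite in_itv/= => /df dft.
  by have [] := is_derive_line dft.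
rewrite in_itv/= => cd; rewrite scale0r add0r subr0 mulrC.
by exists c.
Qed.

(** The mean value theorem along [u], applied to the increment of [f] along [v],
    and then along [v].  The second difference is symmetric in [u] and [v], while
    the mixed derivative on the right is not. *)
Lemma second_difference_mvt U f u v y (d : R) : 0 <= d ->
  (forall s t, 0 <= s <= d -> 0 <= t <= d -> U (s *: u + (t *: v + y))) ->
  (forall z, U z -> derivable f z u) ->
  (forall z, U z -> derivable ('D_u f) z v) ->
  exists2 st : R * R, (0 <= st.1 <= d) && (0 <= st.2 <= d) &
    f (d *: u + (d *: v + y)) - f (d *: u + y) - f (d *: v + y) + f y
    = d * d * 'D_v ('D_u f) (st.1 *: u + (st.2 *: v + y)).
Proof.
move=> d0 Ud fu fuv.
have dd : 0 <= d <= d by rewrite d0 lexx.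
pose phi z := f (d *: v + z) - f z.
have Ud0 s : 0 <= s <= d -> U (s *: u + y).
  by move=> sd; have := Ud s 0 sd; rewrite scale0r add0r; apply; rewrite lexx.
have shE z h : d *: v + (h *: u + z) = h *: u + (d *: v + z) by rewrite addrCA.
have du s : 0 <= s <= d -> derivable (fun z => f (d *: v + z)) (s *: u + y) u.
  move=> sd; have := fu (d *: v + (s *: u + y)).
  rewrite /derivable /=; under eq_fun do rewrite -shE.
  by apply; rewrite addrCA; apply: Ud.
have Du s : 'D_u (fun z => f (d *: v + z)) (s *: u + y) = 'D_u f (d *: v + (s *: u + y)).
  by rewrite /derive /=; under eq_fun do rewrite (shE (s *: u + y)).
have [|s sd phiE] := @segment_mvt phi y u d d0.
  by move=> s sd; apply: derivableB; [exact: du|apply: fu; exact: Ud0].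
have [|t td DE] := @segment_mvt ('D_u f) (s *: u + y) v d d0.
  by move=> t td; apply: fuv; rewrite addrCA; exact: Ud.
exists (s, t) => /=; first by rewrite sd td.
move: phiE; rewrite deriveB; [|exact: du|by apply: fu; exact: Ud0].
rewrite Du DE mulrA [_ + (s *: u + y)]addrCA => <-.
rewrite /phi [d *: v + (_ + _)]addrCA; ring.
Qed.

(** Both mixed derivatives are taken at points of a small parallelogram at [y] as
    the same second difference quotient, so by continuity they agree at [y]. *)
Lemma derive_comm U f u v y : open U -> U y ->
  (forall z, U z -> derivable f z u) -> (forall z, U z -> derivable f z v) ->
  (forall z, U z -> derivable ('D_u f) z v) ->
  (forall z, U z -> derivable ('D_v f) z u) ->
  {for y, continuous ('D_v ('D_u f))} -> {for y, continuous ('D_u ('D_v f))} ->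
  'D_v ('D_u f) y = 'D_u ('D_v f) y.
Proof.
move=> oU Uy fu fv fuv fvu cuv cvu.
apply/eqP; rewrite -subr_eq0 -normr_le0; apply/ler_addgt0Pl => e e0; rewrite addr0.
have e2 : 0 < e / 2 by rewrite divr_gt0.
have : \forall z \near y, [/\ U z, `|'D_v ('D_u f) y - 'D_v ('D_u f) z| <= e / 2 &
    `|'D_u ('D_v f) y - 'D_u ('D_v f) z| <= e / 2].
  have Un : nbhs y U by exact: open_nbhs_nbhs.
  have /cvgrPdist_le/(_ _ e2) n1 := cuv.
  have /cvgrPdist_le/(_ _ e2) n2 := cvu.
  have n12 := @filterI _ _ (nbhs_filter y) _ _ Un (@filterI _ _ (nbhs_filter y) _ _ n1 n2).
  by apply: (@filterS _ _ (nbhs_filter y) _ _ _ n12) => z [Uz [h1 h2]]; exact: And3 Uz h1 h2.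
move=> /nbhs_ballP[r /= r0 Br].
(* small enough for the parallelogram of sides [d u] and [d v] to fit in the ball *)
pose d := r / (2 * (`|u| + `|v| + 1)).
have w0 : 0 < `|u| + `|v| + 1 by rewrite ltr_wpDl ?addr_ge0.
have d0 : 0 < d by rewrite divr_gt0// mulr_gt0.
have Bd s t : 0 <= s <= d -> 0 <= t <= d -> ball y r (s *: u + (t *: v + y)).
  move=> /andP[s0 sd] /andP[t0 td]; rewrite -ball_normE /= addrA opprD addrCA subrr addr0 normrN.
  apply: le_lt_trans (ler_normD _ _) _; rewrite !normrZ !ger0_norm//.
  have -> : r = 2 * (d * (`|u| + `|v| + 1)) by rewrite /d; field; rewrite gt_eqF.
  have h1 : s * `|u| <= d * `|u| by rewrite ler_wpM2r.
  have h2 : t * `|v| <= d * `|v| by rewrite ler_wpM2r.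
  have h3 : 0 <= d * `|u| by rewrite mulr_ge0// ltW.
  have h4 : 0 <= d * `|v| by rewrite mulr_ge0// ltW.
  lra.
have Ud s t : 0 <= s <= d -> 0 <= t <= d -> U (s *: u + (t *: v + y)).
  by move=> sd td; have [] := Br _ (Bd _ _ sd td).
have [[s t] /= /andP[sd td] E1] := second_difference_mvt (ltW d0) Ud fu fuv.
have Ud' s' t' : 0 <= s' <= d -> 0 <= t' <= d -> U (s' *: v + (t' *: u + y)).
  by move=> sd' td'; rewrite addrCA; exact: Ud.
have [[s' t'] /= /andP[sd' td'] E2] := second_difference_mvt (ltW d0) Ud' fv fvu.
have E : 'D_v ('D_u f) (s *: u + (t *: v + y)) = 'D_u ('D_v f) (t' *: u + (s' *: v + y)).
  apply: (mulfI (mulf_neq0 (lt0r_neq0 d0) (lt0r_neq0 d0))).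
  rewrite [t' *: u + _]addrCA; apply: (etrans (esym E1)); apply: (etrans _ E2).
  by rewrite [d *: v + (_ + _)]addrCA [X in X + _]addrAC.
have [_ h1 _] := Br _ (Bd _ _ sd td); have [_ _ h2] := Br _ (Bd _ _ td' sd').
apply: dist_half_trans h2; rewrite -E; exact: h1.
Qed.

End MixedPartials.

(** * Derivatives of matrix-valued functions *)

Section MatrixDerivative.
Context {R : realType} {V : normedModType R}.

Lemma is_derive_mx a b (f : V -> 'M[R]_(a, b)) x v (df : 'M[R]_(a, b)) :
  is_derive x v f df <->
  forall i j, is_derive x v (fun z => f z i j) (df i j).
Proof.
split=> [[dfx <-] i j|h].
  have /derivable_mxP dij := dfx.
  by split; [exact: dij|rewrite derive_mx// mxE].
have dfx : derivable f x v by apply/derivable_mxP => i j; have [] := h i j.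
split=> //; rewrite derive_mx//; apply/matrixP => i j; rewrite mxE.
by have [_ ->] := h i j.
Qed.

Lemma is_derive_bigsum (I : Type) (r : seq I) (h : I -> V -> R) (dh : I -> R) x v :
  (forall i, is_derive x v (h i) (dh i)) ->
  is_derive x v (fun z => \sum_(i <- r) h i z) (\sum_(i <- r) dh i).
Proof.
move=> H; elim: r => [|i r IH].
  rewrite big_nil; under eq_fun do rewrite big_nil; exact: is_derive_cst.
rewrite big_cons; under eq_fun do rewrite big_cons; exact: is_deriveD.
Qed.

Lemma is_derive_mulmx a b c (f : V -> 'M[R]_(a, b)) (g : V -> 'M[R]_(b, c))
    x v df dg :
  is_derive x v f df -> is_derive x v g dg ->
  is_derive x v (fun z => f z *m g z) (df *m g x + f x *m dg).
Proof.
move=> /is_derive_mx hf /is_derive_mx hg; apply/is_derive_mx => i k.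
under eq_fun do rewrite mxE; rewrite !mxE -big_split /=.
apply: is_derive_bigsum => j.
have := is_deriveM (hf i j) (hg j k).
by rewrite addrC [g x j k *: _]mulrC.
Qed.

Lemma is_derive_mulmx_cst a b c (f : V -> 'M[R]_(a, b)) (C : 'M[R]_(b, c)) x v df :
  is_derive x v f df -> is_derive x v (fun z => f z *m C) (df *m C).
Proof.
move=> hf; have := is_derive_mulmx hf (is_derive_cst C x v).
by rewrite mulmx0 addr0.
Qed.

Lemma is_derive_trmx a b (f : V -> 'M[R]_(a, b)) x v df :
  is_derive x v f df -> is_derive x v (fun z => (f z)^T) df^T.
Proof.
move=> /is_derive_mx hf; apply/is_derive_mx => i j.
by under eq_fun do rewrite mxE; rewrite mxE.
Qed.

Lemma derivable_det n (f : V -> 'M[R]_n) x v :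
  derivable f x v -> derivable (fun z => \det (f z)) x v.
Proof.
elim: n f => [f _|n IH f /derivable_mxP df].
  by under eq_fun do rewrite det_mx00; exact: derivable_cst.
under eq_fun do rewrite (expand_det_row _ ord0).
have := @is_derive_bigsum _ (index_enum 'I_n.+1) (fun j z => f z ord0 j * cofactor (f z) ord0 j).
move=> H; apply: (@ex_derive _ _ _ _ _ _ _ (H _ x v _)) => j.
apply/derivableP; apply: derivableM; first exact: df.
rewrite /cofactor; apply: derivableM; first exact: derivable_cst.
apply: IH; apply/derivable_mxP => i k.
rewrite (_ : (fun z => _) = (fun z => f z (lift ord0 i) (lift j k))); first exact: df.
by apply/funext => z; rewrite !mxE.
Qed.

Lemma derivable_invmx n (f : V -> 'M[R]_n) x v :
  (\forall z \near x, f z \in unitmx) ->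
  derivable f x v -> derivable (fun z => invmx (f z)) x v.
Proof.
move=> fu df.
have fx : f x \in unitmx by exact: nbhs_singleton fu.
apply: (@near_eq_derivable _ _ _ (fun z => (\det (f z))^-1 *: \adj (f z))).
  by near=> z; rewrite /invmx (near fu z).
have dd := derivable_det df.
have /derivable_mxP dfij := df.
apply/derivable_mxP => i j; under eq_fun do rewrite !mxE.
apply: derivableM.
  by apply: derivableV => //; rewrite -unitfE -unitmxE.
apply: derivableM; first exact: derivable_cst.
apply: derivable_det; apply/derivable_mxP => k l.
rewrite (_ : (fun z => _) = (fun z => f z (lift j k) (lift i l))).
  exact: dfij.
by apply/funext => z; rewrite !mxE.
Unshelve. all: by end_near. Qed.

End MatrixDerivative.

(** * Smooth matrix-valued functions on an open set *)

Section CkEntries.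
Context {R : realType} {m : nat}.
Implicit Types U : set 'rV[R]_m.

Lemma near_partial_eq (W : normedModType R) U (f g : 'rV[R]_m -> W) k y :
  open U -> (forall z, U z -> f z = g z) -> U y -> partial k f y = partial k g y.
Proof.
move=> oU fg Uy; apply: near_eq_derive.
by near do apply: fg; exact: open_nbhs_nbhs.
Unshelve. all: by end_near. Qed.

Lemma Ck_on_eq (W : normedModType R) U k (f g : 'rV[R]_m -> W) :
  open U -> (forall z, U z -> f z = g z) -> Ck_on k U f -> Ck_on k U g.
Proof.
move=> oU; elim: k f g => [|k IH] f g fg /=.
  move=> cf y Uy.
  have : \forall z \near y, f z = g z.
    by near do apply: fg; exact: open_nbhs_nbhs.
  move=> nfg; change (g @ y --> g y); rewrite -(fg y Uy).
  by apply: cvg_trans (cf y Uy); apply: (@near_eq_cvg _ _ _ (nbhs_filter y) f g); exact: nfg.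
move=> h i; have [df cf] := h i; split.
  move=> y Uy; apply: near_eq_derivable (df y Uy).
  by near do apply: fg; exact: open_nbhs_nbhs.
by apply: IH cf => z Uz; exact: near_partial_eq fg Uz.
Unshelve. all: by end_near. Qed.

Lemma Ck_on_mx U k a b (f : 'rV[R]_m -> 'M[R]_(a, b)) : open U ->
  Ck_on k U f <-> forall i j, Ck_on k U (fun z => f z i j).
Proof.
move=> oU; elim: k f => [|k IH] f /=; split.
- move=> cf i j y Uy; apply: (@cvg_comp _ _ _ f (fun M : 'M[R]_(a, b) => M i j)).
    exact: cf.
  exact: coord_continuous.
- move=> cf y Uy; apply/(@cvgrPdist_le _ _ _ _ (nbhs_filter y)) => /= e e0.
  have : \forall z \near y, forall i : 'I_a * 'I_b,
      `|f y i.1 i.2 - f z i.1 i.2| <= e.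
    apply: (@filter_forall _ _ _ _ (nbhs_filter y)) => i.
    by move/cvgrPdist_le : (cf i.1 i.2 y Uy); apply.
  apply: (@filterS _ _ (nbhs_filter y)) => z fz.
  rewrite /Num.Def.normr/= mx_normrE (bigmax_le _ (ltW e0))//= => i _.
  by rewrite !mxE/=; exact: fz.
- move=> cf i j l; have [df cl] := cf l; split=> [y Uy|].
    by have /derivable_mxP := df y Uy; apply.
  apply: Ck_on_eq ((IH _).1 cl i j) => // z Uz.
  by rewrite /partial derive_mx ?mxE//; exact: df.
- move=> cf l; have dl y (Uy : U y) : derivable f y (delta_mx 0 l : 'rV[R]_m).
    by apply/derivable_mxP => i j; have [+ _] := cf i j l; apply.
  split=> //; apply/IH => i j; have [_ cl] := cf i j l.
  apply: Ck_on_eq cl => // z Uz.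
  by rewrite /partial derive_mx ?mxE//; exact: dl.
Qed.

Lemma partialP (W : normedModType R) U k l (f : 'rV[R]_m -> W) y :
  Ck_on k.+1 U f -> U y -> is_derive y (delta_mx 0 l : 'rV[R]_m) f (partial l f y).
Proof. by move=> cf Uy; apply: derivableP; have [df _] := cf l; exact: df. Qed.

Lemma partial_mxE U k l a b (f : 'rV[R]_m -> 'M[R]_(a, b)) i j y :
  Ck_on k.+1 U f -> U y ->
  partial l f y i j = partial l (fun z => f z i j) y.
Proof.
by move=> cf Uy; have [df _] := cf l; rewrite /partial derive_mx ?mxE//; exact: df.
Qed.

Lemma partial_comm U a b (f : 'rV[R]_m -> 'M[R]_(a, b)) i j y :
  open U -> U y -> Ck_on 2 U f ->
  partial i (partial j f) y = partial j (partial i f) y.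
Proof.
move=> oU Uy cf; apply/matrixP => r s.
have cfi l : Ck_on 1 U (partial l f) by have [] := cf l.
have E l k : partial k (partial l f) y r s
    = partial k (partial l (fun z => f z r s)) y.
  rewrite (partial_mxE k r s (cfi l) Uy).
  by apply: (near_partial_eq k oU _ Uy) => z Uz; exact: (partial_mxE l r s cf Uz).
apply: (etrans (E j i)); apply: (etrans _ (esym (E i j))).
have c2 := (Ck_on_mx _ _ oU).1 cf r s.
have [di ci] := c2 i; have [dj cj] := c2 j.
have [dij cij] := ci j; have [dji cji] := cj i.
exact: (derive_comm oU Uy dj di dji dij (cji y Uy) (cij y Uy)).
Qed.

End CkEntries.

(** * Isometric maps into Minkowski space *)

Section LocalGauss.
Context {R : realType} {m N : nat}.
Variables (U : set 'rV[R]_m) (F : 'rV[R]_m -> 'rV[R]_N.+1).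
Variables (g : 'rV[R]_m -> 'M[R]_m).
Local Notation eta := (@lorentz_mx R N).
Local Notation q := (bilin eta).
Local Notation e_ k := (delta_mx 0 k : 'rV[R]_m).
Local Notation Gam := (christoffel g).
Hypothesis oU : open U.
Hypothesis smF : smooth_on U F.
Hypothesis gF : forall y u v, U y -> lorentz ('D_u F y) ('D_v F y) = bilin (g y) u v.
Hypothesis g_pos : forall y u, U y -> u != 0 -> 0 < bilin (g y) u u.
Hypothesis FF : forall y, U y -> lorentz (F y) (F y) = -1.

Definition jac y : 'M[R]_(m, N.+1) := \matrix_(i, a) partial i F y 0 a.

Definition hess k := partial k jac.

(** Row [j] is the normal part of the second derivative in directions [k, j]. *)
Definition second_form k y := hess k y - Gam k y *m jac y.

Lemma jac_smooth k : Ck_on k U jac.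
Proof.
apply/Ck_on_mx => // i a.
have cF : Ck_on k U (partial i F) by have [] := smF k.+1 i.
have := (Ck_on_mx _ _ oU).1 cF 0 a.
by apply: Ck_on_eq => // z _; rewrite mxE.
Qed.

Lemma row_jac i y : row i (jac y) = partial i F y.
Proof. by apply/rowP => a; rewrite !mxE. Qed.

Lemma hessE k i y : U y -> row i (hess k y) = partial k (partial i F) y.
Proof.
move=> Uy; apply/rowP => a; rewrite mxE /hess (partial_mxE k i a (jac_smooth 1) Uy).
have cF : Ck_on 1 U (partial i F) by have [] := smF 2 i.
rewrite (partial_mxE k 0 a cF Uy).
by apply: (near_partial_eq k oU _ Uy) => z _; rewrite mxE.
Qed.

Lemma hess_sym k i y : U y -> row i (hess k y) = row k (hess i y).
Proof.
move=> Uy; rewrite (hessE k i Uy) (hessE i k Uy).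
exact: (partial_comm k i oU Uy (smF 2)).
Qed.

Lemma bilin_delta (A : 'M[R]_m) i j : bilin A (e_ i) (e_ j) = A i j.
Proof. by rewrite /bilin -rowE trmx_delta -colE !mxE. Qed.

Lemma metricE y : U y -> g y = jac y *m eta *m (jac y)^T.
Proof.
move=> Uy; apply/matrixP => i j.
rewrite -bilin_delta -gF// lorentzE -/(partial i F y) -/(partial j F y).
rewrite -[RHS]bilin_delta /bilin !mulmxA -rowE row_jac -[_ *m _^T *m _]mulmxA.
by rewrite -trmx_mul -rowE row_jac.
Qed.

Lemma metric_unit y : U y -> g y \in unitmx.
Proof.
move=> Uy; rewrite -row_free_unit; apply: inj_row_free => v vg.
apply/eqP; apply: contraT => v0; have := g_pos Uy v0.
by rewrite /bilin vg mul0mx mxE ltxx.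
Qed.

Lemma is_derive_jac k y : U y -> is_derive y (e_ k) jac (hess k y).
Proof. by move=> Uy; exact: (partialP k (jac_smooth 1) Uy). Qed.

Lemma derivable_hess k i y : U y -> derivable (hess k) y (e_ i).
Proof.
by move=> Uy; have [_ c1] := jac_smooth 2 k; have [dh _] := c1 i; exact: dh.
Qed.

Lemma near_U y : U y -> nbhs y U.
Proof. by move=> Uy; exact: open_nbhs_nbhs. Qed.

Lemma near_eq_on (T : Type) (f f' : 'rV[R]_m -> T) y : U y ->
  (forall z, U z -> f z = f' z) -> \forall z \near y, f z = f' z.
Proof.
by move=> Uy ff'; apply: (@filterS _ _ (nbhs_filter y) _ _ _ (near_U Uy)).
Qed.

Lemma is_derive_metric k y : U y ->
  is_derive y (e_ k) g (hess k y *m eta *m (jac y)^T + jac y *m eta *m (hess k y)^T).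
Proof.
move=> Uy; have dj := is_derive_jac k Uy.
apply: (@near_eq_is_derive _ _ _ (fun z => jac z *m eta *m (jac z)^T)).
  by apply: near_eq_on => // z Uz; rewrite metricE.
exact: is_derive_mulmx (is_derive_mulmx_cst eta dj) (is_derive_trmx dj).
Qed.

Lemma christoffelE k y : U y ->
  Gam k y = hess k y *m eta *m (jac y)^T *m invmx (g y).
Proof.
move=> Uy; rewrite /christoffel; congr (_ *m _).
have dgE i : partial i g y
    = hess i y *m eta *m (jac y)^T + jac y *m eta *m (hess i y)^T.
  by have [_] := is_derive_metric i Uy.
have := @koszul_gram _ _ _ eta (jac y) tr_lorentz_mx (hess^~ y)
  (fun i => partial i g y) k (fun i l => hess_sym l i Uy) dgE; exact.
Qed.

Lemma christoffel_metric k y : U y ->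
  Gam k y *m g y = hess k y *m eta *m (jac y)^T.
Proof. by move=> Uy; rewrite christoffelE// mulmxKV// metric_unit. Qed.

(** Near [y] the symbol is given by [christoffelE], where every factor is
    differentiable, the inverse of the metric by Cramer's formula. *)
Lemma derivable_christoffel k i y : U y -> derivable (Gam k) y (e_ i).
Proof.
move=> Uy.
apply: (@near_eq_derivable _ _ _ (fun z => hess k z *m eta *m (jac z)^T *m invmx (g z))).
  by apply: near_eq_on => // z Uz; rewrite christoffelE.
have dh := derivableP (@derivable_hess k i y Uy).
have dg : derivable g y (e_ i) by have [] := is_derive_metric i Uy.
have di : derivable (fun z => invmx (g z)) y (e_ i).
  apply: derivable_invmx => //.
  by apply: (@filterS _ _ (nbhs_filter y) _ _ _ (near_U Uy)) => z; exact: metric_unit.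
have [//] := is_derive_mulmx (is_derive_mulmx
  (is_derive_mulmx_cst eta dh) (is_derive_trmx (is_derive_jac i Uy)))
  (derivableP di).
Qed.

Lemma second_form_normal k y : U y -> second_form k y *m eta *m (jac y)^T = 0.
Proof.
move=> Uy; rewrite /second_form !mulmxBl -christoffel_metric// -!mulmxA.
by rewrite [jac y *m _]mulmxA -metricE// subrr.
Qed.

(** The second form is the Hessian followed by a fixed projection to the normal
    space, so it inherits the symmetry of the Hessian. *)
Lemma second_form_sym k i y : U y -> row i (second_form k y) = row k (second_form i y).
Proof.
move=> Uy.
have E l : second_form l y
    = hess l y *m (1%:M - eta *m (jac y)^T *m invmx (g y) *m jac y).
  by rewrite mulmxBr mulmx1 !mulmxA -(christoffelE l Uy).
by rewrite (E k) (E i) !row_mul (hess_sym k i Uy).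
Qed.

(** [gauss_codazzi_tangent] for [i, j] minus the same for [j, i]: the third
    derivatives of the map cancel by symmetry. *)
Lemma gauss_equation_mx i j y : U y ->
  curv_mx g i j y *m g y =
    second_form j y *m eta *m (second_form i y)^T
    - second_form i y *m eta *m (second_form j y)^T.
Proof.
move=> Uy.
have half i' j' : (partial i' (Gam j') y + Gam j' y *m Gam i' y) *m g y =
    partial i' (hess j') y *m eta *m (jac y)^T
    + second_form j' y *m eta *m (second_form i' y)^T.
  have dG := derivableP (@derivable_christoffel j' i' y Uy).
  have dh := derivableP (@derivable_hess j' i' y Uy).
  have [_ E1] := is_derive_mulmx dG (is_derive_metric i' Uy).
  have [_ E2] := is_derive_mulmx (is_derive_mulmx_cst eta dh)
    (is_derive_trmx (is_derive_jac i' Uy)).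
  have : 'D_(e_ i') (fun z => Gam j' z *m g z) y
      = 'D_(e_ i') (fun z => hess j' z *m eta *m (jac z)^T) y.
    by apply: near_eq_derive; apply: near_eq_on => // z Uz; exact: christoffel_metric.
  rewrite E1 E2 => E.
  apply: gauss_codazzi_tangent E.
    exact: christoffel_metric.
  exact: second_form_normal.
rewrite /curv_mx.
have -> : partial i (Gam j) y - partial j (Gam i) y + Gam j y *m Gam i y - Gam i y *m Gam j y
   = (partial i (Gam j) y + Gam j y *m Gam i y) - (partial j (Gam i) y + Gam i y *m Gam j y).
  by rewrite opprD addrACA addrA.
rewrite mulmxBl !half.
have -> : partial i (hess j) y = partial j (hess i) y.
  exact: (partial_comm i j oU Uy (jac_smooth 2)).
by rewrite opprD addrACA subrr add0r.
Qed.

Lemma gauss_equation y (X Y Z W : 'rV[R]_m) : U y ->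
  bilin (g y) (curvature g y X Y Z) W
  = gauss eta (fun V V' => V *m along (second_form^~ y) V') X Y Z W.
Proof.
move=> Uy; apply: gauss_along.
  by move=> i k; exact: second_form_sym.
by move=> i j; exact: gauss_equation_mx.
Qed.

Lemma is_derive_map k y : U y -> is_derive y (e_ k) F (partial k F y).
Proof. by move=> Uy; exact: (partialP k (smF 1) Uy). Qed.

(** Differentiate [<F, F> = -1]. *)
Lemma jac_position y : U y -> jac y *m eta *m (F y)^T = 0.
Proof.
move=> Uy; apply/row_matrixP => i; rewrite !row_mul row_jac row0.
have dF := is_derive_map i Uy.
have [_ E] := is_derive_mulmx (is_derive_mulmx_cst eta dF) (is_derive_trmx dF).
have E0 : 'D_(e_ i) (fun z => F z *m eta *m (F z)^T) y = 0.
  rewrite -(derive_cst (- 1%:M) y (e_ i)); apply: near_eq_derive.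
  apply: near_eq_on => // z Uz; apply/matrixP => r s.
  by rewrite !ord1 -[LHS]/(bilin eta (F z) (F z)) -lorentzE FF// /cst !mxE eqxx.
move: E; rewrite E0; move: (partial i F y) => v E.
have vF : v *m eta *m (F y)^T = F y *m eta *m v^T.
  by apply/matrixP => r s; rewrite !ord1; exact: (bilinC v (F y) tr_lorentz_mx).
apply/eqP; move/esym/eqP: E; rewrite -vF -mulr2n -scaler_nat scaler_eq0.
by rewrite pnatr_eq0.
Qed.

(** Differentiating [<dF, F> = 0] gives [<ddF, F> = - <dF, dF>], and the
    tangential part of [ddF] is orthogonal to [F]. *)
Lemma second_form_position y X Y : U y ->
  lorentz (Y *m along (second_form^~ y) X) (F y) = - bilin (g y) Y X.
Proof.
move=> Uy.
have hF k : hess k y *m eta *m (F y)^T = - (g y *m (e_ k)^T).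
  have dF := is_derive_map k Uy.
  have [_ E] := is_derive_mulmx (is_derive_mulmx_cst eta (is_derive_jac k Uy))
    (is_derive_trmx dF).
  have E0 : 'D_(e_ k) (fun z => jac z *m eta *m (F z)^T) y = 0.
    rewrite -(derive_cst (0 : 'M[R]_(m, 1)) y (e_ k)); apply: near_eq_derive.
    by apply: near_eq_on => // z Uz; rewrite jac_position.
  move: E; rewrite E0 -row_jac => /esym/eqP; rewrite addr_eq0 => /eqP ->.
  by rewrite metricE// rowE trmx_mul !mulmxA.
have sF k : second_form k y *m eta *m (F y)^T = - (g y *m (e_ k)^T).
  have -> : second_form k y *m eta *m (F y)^T
      = hess k y *m eta *m (F y)^T - Gam k y *m (jac y *m eta *m (F y)^T).
    by rewrite /second_form; move: (Gam k y) => G; rewrite !mulmxBl !mulmxA.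
  by rewrite hF jac_position// mulmx0 subr0.
have -> : lorentz (Y *m along (second_form^~ y) X) (F y)
    = (Y *m (along (second_form^~ y) X *m eta *m (F y)^T)) 0 0.
  by rewrite lorentzE /bilin !mulmxA.
have -> : along (second_form^~ y) X *m eta *m (F y)^T = - (g y *m X^T).
  rewrite /along !mulmx_suml {2}[X]row_sum_delta linear_sum mulmx_sumr -sumrN.
  apply: eq_bigr => k _; rewrite -!scalemxAl sF linearZ /=.
  by rewrite -scalemxAr scalerN.
by rewrite mulmxN mxE mulmxA.
Qed.

Section LocalKaehler.
Variable J : 'rV[R]_m -> 'M[R]_m.
Hypothesis smJ : smooth_on U J.
Hypothesis JJ : forall y, U y -> J y *m J y = - 1%:M.
Hypothesis Jorth : forall y (u v : 'rV[R]_m), U y ->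
  bilin (g y) (u *m J y) (v *m J y) = bilin (g y) u v.
Hypothesis Jpar : forall y k, U y ->
  partial k J y + J y *m Gam k y - Gam k y *m J y = 0.

(** The Ricci identity: antisymmetrizing the derivative of
    [partial k J = Gam_k J - J Gam_k] leaves the commutator of [J] with the
    curvature. *)
Lemma curv_mx_J i j y : U y -> curv_mx g i j y *m J y = J y *m curv_mx g i j y.
Proof.
move=> Uy.
have pJ k z : U z -> partial k J z = Gam k z *m J z - J z *m Gam k z.
  by move=> Uz; apply/eqP; rewrite -subr_eq0 opprB addrA Jpar.
have dJ k : is_derive y (e_ k) J (Gam k y *m J y - J y *m Gam k y).
  by rewrite -pJ//; exact: (partialP k (smJ 1) Uy).
have ppJ a b : partial a (partial b J) y =
    partial a (Gam b) y *m J y + Gam b y *m (Gam a y *m J y - J y *m Gam a y)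
    - ((Gam a y *m J y - J y *m Gam a y) *m Gam b y + J y *m partial a (Gam b) y).
  have dG := derivableP (@derivable_christoffel b a y Uy).
  have [_ <-] := is_deriveB (is_derive_mulmx dG (dJ a)) (is_derive_mulmx (dJ a) dG).
  by apply: near_eq_derive; apply: near_eq_on => // z Uz; exact: pJ.
have := partial_comm i j oU Uy (smJ 2); rewrite !ppJ /curv_mx.
move: (partial i (Gam j) y) (partial j (Gam i) y) (Gam i y) (Gam j y) (J y).
move=> dij dji Gi Gj K E.
rewrite !(mulmxBl, mulmxBr, mulmxDl, mulmxDr, mulmxN, mulNmx) in E *.
apply/eqP; rewrite -subr_eq0; move/eqP: E; rewrite -subr_eq0.
rewrite !mulmxA; congr (_ == 0).
move: (dij *m K) (dji *m K) (K *m dij) (K *m dji) (Gj *m Gi *m K) (Gi *m Gj *m K)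
  (Gj *m K *m Gi) (Gi *m K *m Gj) (K *m Gi *m Gj) (K *m Gj *m Gi) => *.
by apply/matrixP => r s; rewrite !mxE; ring.
Qed.

Lemma curvature_J y (X Y Z : 'rV[R]_m) : U y ->
  curvature g y X Y (Z *m J y) = curvature g y X Y Z *m J y.
Proof.
move=> Uy; rewrite /curvature mulmx_suml; apply: eq_bigr => i _.
rewrite mulmx_suml; apply: eq_bigr => j _.
by rewrite -scalemxAl -!mulmxA curv_mx_J.
Qed.

Lemma exists_nonpos_holomorphic y : U y -> (2 * (N.+1 - m) < m)%N ->
  exists2 Z : 'rV[R]_m, Z != 0 & sectional_curvature g y Z (Z *m J y) <= 0.
Proof.
move=> Uy codim.
have gsym : (g y)^T = g y.
  by rewrite metricE// !trmx_mul trmxK tr_lorentz_mx mulmxA.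
pose A := along (second_form^~ y).
have Asym X Y : Y *m A X = X *m A Y.
  by apply: along_sym => i k; exact: second_form_sym.
have [||||||||Z Z0 KZ] := @holomorphic_nonpos R m N (jac y) A (J y) (F y) codim.
- by rewrite -metricE// metric_unit.
- by move=> X Y t; exact: alongD.
- move=> X; rewrite /A /along !mulmx_suml big1// => k _.
  by rewrite -!scalemxAl second_form_normal// scaler0.
- exact: Asym.
- exact: JJ.
- move=> X Y Z W; rewrite -!gauss_equation// curvature_J//; exact: Jorth.
- exact: FF.
- by move=> X Y; rewrite !second_form_position// Jorth.
exists Z => //; rewrite /sectional_curvature Jorth//.
(* [Z] and [J Z] are orthogonal and of equal length, so the denominator is
   [|Z|^4]. *)
have -> : bilin (g y) Z (Z *m J y) = 0.
  have : bilin (g y) Z (Z *m J y) = - bilin (g y) Z (Z *m J y).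
    rewrite -{1}Jorth// mulJJ ?JJ// bilinNr; congr (- _); exact: bilinC.
  lra.
rewrite gauss_equation// expr0n subr0; apply: mulr_le0_ge0; last first.
  by rewrite invr_ge0 mulr_ge0// ltW// g_pos.
rewrite /gauss [X in X - _](bilinC _ _ tr_lorentz_mx) -/A.
by rewrite [X in _ - bilin _ _ X]Asym.
Qed.

End LocalKaehler.
End LocalGauss.

(** * Nonexistence of the immersion *)

Theorem theorem3 (R : realType) (n p : nat) (M : kaehler_manifold R n) :
  (3 <= n)%N ->
  (p <= n - 2)%N ->
  (exists x : M, positive_holomorphic_curvature_at x) ->
  ~ exists f : M -> 'rV[R]_(2 * n + p).+1,
      isometric_immersion (kaehler_metric M) f.
Proof.
move=> n3 pn [x [c cx pos]] [f [fH fI]].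
have [smF gF] := fI c.
have Uy : chart_im (atlas c) (chart_map (atlas c) x) by exists x.
have [Z Z0] : exists2 Z : 'rV[R]_(2 * n), Z != 0 &
    sectional_curvature (kaehler_metric M c) (chart_map (atlas c) x) Z
      (Z *m kaehler_J M c (chart_map (atlas c) x)) <= 0.
  apply: (exists_nonpos_holomorphic (U := chart_im (atlas c))
    (F := f \o chart_inv (atlas c))) => //.
  - exact: chart_im_open.
  - by move=> y u v Vy; have [_] := gF y Vy; apply.
  - by move=> y u; exact: metric_pos.
  - by move=> y _; have [] := fH (chart_inv (atlas c) y).
  - exact: cplx_smooth.
  - by move=> y; exact: cplx_sqr.
  - by move=> y u v; exact: kaehler_hermitian.
  - by move=> y k; exact: kaehler_parallel.
  (* the normal space in Minkowski space has dimension p + 1 <= n - 1 *)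
  - by lia.
by rewrite leNgt pos.
Qed.
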